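(* Let $X$ be a quasi-sparse metric space whose sparsity order at infinity $\sigma(X)$ exists and satisfies $0<\sigma(X)\le 1$. Then its upper tryposity order at infinity satisfies $\overline{\tau}(X)\ge\sigma(X)$.
   Context: Sparsity. For an unbounded metric space $(X,d)$ with base point $x_0$, let $s(R)=\inf\{d(x,y):x,y\in X\setminus B(x_0,R),\ x\ne y\}$, where $B(x_0,R)$ is the open ball. $X$ is sparse if it is unbounded and $\lim_{R\to\infty}s(R)=\infty$ (independent of $x_0$). For sparse $X$ the sparsity order at infinity is $\sigma(X)=\lim_{R\to\infty}\frac{\log s(R)}{\log R}$ when this limit (in $[0,\infty]$) exists; it is independent of $x_0$. A sparse skeleton of a metric space $X$ is a sparse subspace $X'\subset X$ such that, for some $A\geq 0$, every point of $X$ is within distance $A$ of $X'$. $X$ is quasi-sparse if it has a sparse skeleton; its sparsity order $\sigma(X)$ is then defined as that of any of its sparse skeletons (existence and value are independent of the choice of skeleton). Tryposity. For a metric space $(X,d)$, with $\overline{B}(x,r)$ the closed ball in $X$, put $hd(x,y)=2\inf\{r:\overline{B}(x,r)\cap\overline{B}(y,r)\ne\emptyset\}$, $ld(x,y)=hd(x,y)-d(x,y)$, and define the convexity gap $\gamma(X)=\sup\{ld(x,y):x,y\in X\}$. For a subset of a metric space, $\gamma$ of the subset is computed by regarding it as a metric space in its own right. The upper tryposity order at infinity of $X$ is $\overline{\tau}(X)=\limsup_{R\to\infty}\frac{\log\gamma(\overline{B}(x_0,R))}{\log R}$, which does not depend on the base point $x_0\in X$. *)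

(* Defs.v *)
From HB Require Import structures.
From mathcomp Require Import all_boot all_order all_algebra.
From mathcomp Require Import all_classical all_reals all_analysis.

Set Implicit Arguments.
Unset Strict Implicit.
Unset Printing Implicit Defensive.

Import Order.TTheory GRing.Theory Num.Theory.
Import numFieldNormedType.Exports.

Local Open Scope classical_set_scope.
Local Open Scope ring_scope.

(* A metric space is a subset Y of an ambient [T : metricType R], with the
   distance [mdist] restricted to Y; the ambient space itself is [set: T].
   Balls, gaps, infima and suprema below are always relative to Y. *)

Definition unbounded {R : realType} {T : metricType R} (Y : set T) : Prop :=
  forall M : R, exists x y, [/\ Y x, Y y & M < mdist x y].

(* s(r): extended-real valued, so that the infimum of an empty family (only
   possible when Y is bounded) is +oo. *)
Definition separation {R : realType} {T : metricType R}
    (Y : set T) (x0 : T) (r : R) : \bar R :=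
  ereal_inf [set (mdist p.1 p.2)%:E | p in
    [set p : T * T | [/\ (Y `\` ball x0 r) p.1, (Y `\` ball x0 r) p.2
                       & p.1 <> p.2]]].

(* The conditions on limits do not depend on the base point; asking for some
   base point (rather than all) makes them weakest as hypotheses. *)
Definition sparse {R : realType} {T : metricType R} (Y : set T) : Prop :=
  unbounded Y /\
  exists2 x0, Y x0 & separation Y x0 r @[r --> +oo] --> (+oo)%E.

Definition sparsity_order_of_sparse {R : realType} {T : metricType R}
    (Y : set T) (sigma : \bar R) : Prop :=
  sparse Y /\
  exists2 x0, Y x0 &
    (lne (separation Y x0 r) / (ln r)%:E)%E @[r --> +oo] --> sigma.

Definition sparse_skeleton {R : realType} {T : metricType R}
    (Y S : set T) : Prop :=
  [/\ S `<=` Y, sparse S &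
      exists2 A : R, 0 <= A &
        forall x, Y x -> exists2 y, S y & mdist x y <= A].

Definition quasi_sparse {R : realType} {T : metricType R} (Y : set T) : Prop :=
  exists S, sparse_skeleton Y S.

(* "sigma(Y) exists and equals sigma": existence and value do not depend on
   the skeleton. *)
Definition sparsity_order {R : realType} {T : metricType R}
    (Y : set T) (sigma : \bar R) : Prop :=
  exists2 S, sparse_skeleton Y S & sparsity_order_of_sparse S sigma.

(* Not the library's [closed_ball], which is the closure of the open ball. *)
Definition cball {R : realType} {T : metricType R}
    (Y : set T) (x : T) (r : R) : set T :=
  Y `&` [set z | mdist x z <= r].

Definition hd {R : realType} {T : metricType R} (Y : set T) (x y : T) : R :=
  2 * inf [set r : R | cball Y x r `&` cball Y y r !=set0].

Definition ld {R : realType} {T : metricType R} (Y : set T) (x y : T) : R :=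
  hd Y x y - mdist x y.

Definition convexity_gap {R : realType} {T : metricType R} (Y : set T) : \bar R :=
  ereal_sup [set (ld Y p.1 p.2)%:E | p in Y `*` Y].

(* [lne 0 = -oo], and the ball around x0 is nonempty for r >= 0, so its gap is
   then a nonnegative extended real. *)
Definition upper_tryposity_order {R : realType} {T : metricType R}
    (Y : set T) (x0 : T) : \bar R :=
  limf_esup (fun r : R => (lne (convexity_gap (cball Y x0 r)) / (ln r)%:E)%E)
    (pinfty_nbhs R).

(* Main.v *)
(** Let [S] be a skeleton of [X] with covering constant [A], and let [x] be a
    point of [S] far from the base point, at distance [R] say. If [D] is the
    distance from [x] to the rest of [S], and [y] in [S] nearly realises it,
    then every point of [X] is within [A] of [x] or of another point of [S],
    hence is at distance at least [D - A] from [y] or from [x]: there is no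
    approximate midpoint of [x] and [y], and [ld x y >= D - 2 A - 1]. As
    [sigma <= 1], sparsity yields [D >= (R / 2) ^ q] for all [q < sigma], both
    for points outside and inside the ball of radius [R / 2], so the ball of
    radius [3 R] has gap at least [(3 R) ^ p] for all [p < q] and [R] large. *)

Require Import Defs.
From mathcomp Require Import all_boot all_order all_algebra.
From mathcomp Require Import all_classical all_reals all_analysis.
From mathcomp Require Import lra.

Set Implicit Arguments.
Unset Strict Implicit.
Unset Printing Implicit Defensive.

Import Order.TTheory GRing.Theory Num.Theory.
Import numFieldNormedType.Exports.

Local Open Scope classical_set_scope.
Local Open Scope ring_scope.

Lemma ld_ge_nearest (R : realType) (T : metricType R) (Y S : set T) (x y : T)
    (A D : R) :
  Y x -> Y y -> (forall z, Y z -> exists2 w, S w & mdist z w <= A) ->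
  (forall w, S w -> w <> x -> D <= mdist x w) -> D <= mdist x y ->
  2 * (D - A) - mdist x y <= ld Y x y.
Proof.
move=> Yx Yy YS xS xy; rewrite /ld /hd lerB // ler_pM2l //.
apply: lb_le_inf.
  exists (mdist x y), y; split; split => //=.
  by rewrite mdistxx mdist_ge0.
move=> r [z [[Yz /= xz] [_ /= yz]]].
have [w Sw zw] := YS z Yz.
(* If [z] is near [x], it is far from [y]; otherwise [z] is near another point of [S], hence far
   from [x]. Either way [r >= D - A]. *)
have [wx|wx] := pselect (w = x).
  have := metric_triangle x z y; rewrite (metric_sym z y) (metric_sym x z) -wx.
  move: xy; rewrite -wx; lra.
have := xS w Sw wx; have := metric_triangle x z w; lra.
Qed.

(** A pair outside the ball at distance below [r ^ q] would bound the infimum by [r ^ q], hence the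
    quotient by [q], as [ln r > 0]. *)
Lemma powR_le_separated_mdist (R : realType) (T : metricType R) (S : set T)
    (s0 x y : T) (q r : R) :
  1 < r -> (q%:E < lne (separation S s0 r) / (ln r)%:E)%E ->
  S x -> S y -> x <> y -> r <= mdist s0 x -> r <= mdist s0 y ->
  r `^ q <= mdist x y.
Proof.
move=> r1 qsep Sx Sy xy rx ry; rewrite leNgt; apply/negP => dlt.
have lnr : 0 < ln r by rewrite ln_gt0.
have sep_le : (separation S s0 r <= (r `^ q)%:E)%E.
  apply: (@le_trans _ _ (mdist x y)%:E); last by rewrite lee_fin ltW.
  apply: ereal_inf_lbound; exists (x, y) => //=.
  by split => //; split => //; rewrite ballEmdist /= => /(le_lt_trans _);
    [move=> /(_ _ rx); rewrite ltxx|move=> /(_ _ ry); rewrite ltxx].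
have sep_ge : (0 <= separation S s0 r)%E.
  by apply/ereal_infP => _ [p _ <-]; rewrite lee_fin mdist_ge0.
move: qsep; rewrite inver gt_eqF // ltNge => /negP; apply.
rewrite lee_pdivrMr // -EFinM -ln_powR -lne_EFin; last first.
  by rewrite powR_gt0 // (lt_trans ltr01).
by rewrite lee_lne // in_itv /= ?leey ?andbT // lee_fin powR_ge0.
Qed.

Lemma le_lne_div_ln (R : realType) (p r : R) (g : \bar R) :
  1 < r -> ((r `^ p)%:E <= g)%E -> (p%:E <= lne g / (ln r)%:E)%E.
Proof.
move=> r1 rg; have lnr : 0 < ln r by rewrite ln_gt0.
have rp : (0 < (r `^ p)%:E)%E by rewrite lte_fin powR_gt0 // (lt_trans ltr01).
rewrite inver gt_eqF // lee_pdivlMr // -EFinM -ln_powR -lne_EFin //.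
rewrite lee_lne // in_itv /= ?leey ?andbT ?ltW //.
exact: lt_le_trans rg.
Qed.

Lemma limf_esup_pinfty_ge (R : realType) (f : R -> \bar R) (a : \bar R) :
  (forall M, exists2 t, M < t & (a <= f t)%E) ->
  (a <= limf_esup f (pinfty_nbhs R))%E.
Proof.
move=> fa; apply/ereal_infP => _ [V [M [_ MV]] <-].
have [t Mt aft] := fa M.
by apply: (le_trans aft); apply: ereal_sup_ubound; exists t => //; exact: MV.
Qed.

(** Write [u ^ q = u ^ (q - p) * u ^ p], which is at least [(C + 6) * u ^ p]: the part [6 * u ^ p]
    dominates [(6 u) ^ p], and [C * u ^ p >= C]. *)
Lemma powR_dominated (R : realType) (p q C u : R) :
  0 <= p -> p < q -> q <= 1 -> 0 <= C -> 1 <= u ->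
  (C + 6) `^ (q - p)^-1 <= u -> (6 * u) `^ p <= u `^ q - C.
Proof.
move=> p0 pq q1 C0 u1 Cu.
have u0 : 0 < u by lra.
have uqp : C + 6 <= u `^ (q - p).
  have /= := ge0_ler_powR (ltW (_ : 0 < q - p)) _ _ Cu.
  rewrite -powRrM mulVf ?powRr1; [|lra|rewrite gt_eqF //; lra].
  by apply; rewrite ?nnegrE ?powR_ge0 //; lra.
have up1 : 1 <= u `^ p by rewrite -(powRr0 u) ler_powR.
have six : 6 `^ p <= 6 :> R.
  by rewrite -[leRHS]powRr1 // ler_powR //; lra.
have -> : u `^ q = u `^ (q - p) * u `^ p.
  rewrite -powRD; first by rewrite subrK.
  by rewrite (gt_eqF u0) implybT.
rewrite powRM; [|lra..].
have := ler_wpM2r (powR_ge0 u p) six.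
have := ler_wpM2r (powR_ge0 u p) uqp.
nra.
Qed.

Lemma unbounded_far (R : realType) (T : metricType R) (Y : set T) (a : T)
    (M : R) :
  unbounded Y -> exists2 x, Y x & M < mdist a x.
Proof.
move=> /(_ (M + M)) [x [y [Yx Yy Mxy]]].
have [Mx|xM] := ltP M (mdist a x); first by exists x.
exists y => //; have := metric_triangle x a y; rewrite (metric_sym x a); lra.
Qed.

Lemma convexity_gap_cball_ge (R : realType) (X : metricType R) (S : set X)
    (A D : R) (x0 s0 x : X) :
  S s0 -> S x -> x <> s0 ->
  (forall z, exists2 w, S w & mdist z w <= A) ->
  mdist x0 s0 + 1 <= mdist s0 x ->
  (forall w, S w -> w <> x -> D <= mdist x w) ->
  ((D - (2 * A + 1))%:E <= convexity_gap (cball setT x0 (3 * mdist s0 x)))%E.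
Proof.
move=> Ss0 Sx xs0 SA far Dle.
pose E := [set mdist x w | w in [set w | S w /\ w <> x]].
have E_lb : has_lbound E by exists 0 => _ [w _ <-]; exact: mdist_ge0.
have Es0 : E (mdist x s0) by exists s0; split => //; exact/nesym.
pose D1 := inf E.
(* The infimum need not be attained; the slack [1] is the [1] in [2 * A + 1]. *)
have [_ [y [Sy yx] <-] xyD1] : exists2 e, E e & e < D1 + 1.
  by apply: inf_adherent => //; split => //; exists (mdist x s0).
have DD1 : D <= D1.
  apply: lb_le_inf; first by exists (mdist x s0).
  by move=> _ [w [Sw wx] <-]; exact: Dle.
have D1le w : S w -> w <> x -> D1 <= mdist x w.
  by move=> Sw wx; apply: ge_inf => //; exists w.
have D1R : D1 <= mdist s0 x.
  by rewrite metric_sym; apply: D1le => //; exact/nesym.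
have Bx : cball setT x0 (3 * mdist s0 x) x.
  split => //=; have := metric_triangle x0 s0 x; have := mdist_ge0 x0 s0; lra.
(* As [s0] competes in the infimum, [y] is within [mdist s0 x + 1] of [x]; the [1] is absorbed by
   the hypothesis [far]. *)
have By : cball setT x0 (3 * mdist s0 x) y.
  split => //=; have := metric_triangle x0 s0 y.
  have := metric_triangle s0 x y; have := mdist_ge0 x0 s0; lra.
apply: (@le_trans _ _ (ld (cball setT x0 (3 * mdist s0 x)) x y)%:E).
  rewrite lee_fin.
  apply: le_trans (ld_ge_nearest (A := A) (D := D1) Bx By _ D1le _).
  - lra.
  - by move=> z _; exact: SA.
  - exact: D1le.
by apply: ereal_sup_ubound; exists (x, y).
Qed.

Theorem proposition3p6 (R : realType) (X : metricType R) (sigma : \bar R)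
    (qsX : quasi_sparse [set: X]%classic)
    (ordX : sparsity_order [set: X]%classic sigma)
    (sigma_gt0 : (0 < sigma)%E) (sigma_le1 : (sigma <= 1)%E) (x0 : X) :
  (sigma <= upper_tryposity_order [set: X]%classic x0)%E.
Proof.
case: ordX => S [_ _ [A A0 SA]] [[Sunb _] [s0 Ss0 Ssigma]].
case: sigma sigma_gt0 sigma_le1 Ssigma => [a| |] //.
rewrite lte_fin lee_fin => a0 a1 Ssigma.
suff main p : 0 < p -> p < a ->
    (p%:E <= upper_tryposity_order [set: X] x0)%E.
  apply/lee_subgt0Pr => e e0.
  (* [main] needs a positive exponent, so [a / 2] replaces [a - e] when [e] is large. *)
  have [ae|ea] := ltP (a - e) (a / 2).
    apply: (@le_trans _ _ (a / 2)%:E); last by apply: main; lra.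
    by rewrite -EFinB lee_fin ltW.
  by rewrite -EFinB; apply: main; lra.
move=> p0 pa.
pose q := (p + a) / 2.
have [pq qa] : p < q /\ q < a by rewrite /q; lra.
have [M [_ qsep]] : \forall r \near +oo,
    (q%:E < lne (separation S s0 r) / (ln r)%:E)%E.
  by apply: (Ssigma [set z | q%:E < z]%E); apply: open_nbhs_nbhs; split;
    [exact: open_ereal_gt_ereal|rewrite /= lte_fin].
apply: limf_esup_pinfty_ge => N.
(* [U] is the threshold of [powR_dominated] for [C = 2 * A + 1]; [K] adds up all the lower bounds
   that half the distance from [s0] to [x] must exceed. *)
pose U := (2 * A + 1 + 6) `^ (q - p)^-1.
pose K := `|M| + `|N| + mdist x0 s0 + U + 1.
have [x Sx Kx] := unbounded_far s0 (2 * K) Sunb.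
have U0 : 0 <= U by exact: powR_ge0.
have d0 := mdist_ge0 x0 s0.
have M0 := normr_ge0 M; have N0 := normr_ge0 N.
have MM := ler_norm M; have NN := ler_norm N.
set u := mdist s0 x / 2.
have uK : K < u by rewrite /u; lra.
have u1 : 1 < u by rewrite /K in uK; lra.
have ru : 3 * mdist s0 x = 6 * u by rewrite /u; lra.
exists (3 * mdist s0 x); first by rewrite ru; rewrite /K in uK; lra.
apply: le_lne_div_ln; first by rewrite ru; lra.
apply: (@le_trans _ _ (u `^ q - (2 * A + 1))%:E).
  rewrite lee_fin ru; apply: powR_dominated; try lra.
  by rewrite -/U; rewrite /K in uK; lra.
apply: (convexity_gap_cball_ge Ss0 Sx).
- by move=> xs; move: u1; rewrite /u xs mdistxx; lra.
- by move=> z; exact: SA.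
- by rewrite /K /u in uK *; lra.
move=> w Sw wx.
have [uw|wu] := leP u (mdist s0 w).
  apply: (@powR_le_separated_mdist _ _ S s0) => //;
    last by rewrite /u in u1 *; lra.
  - by apply: qsep; rewrite /K in uK; lra.
  - exact/nesym.
(* Inside the ball of radius [u], [w] is at distance at least [2 u - u = u] from [x], and
   [u >= u ^ q] because [q <= 1]. *)
apply: (@le_trans _ _ u).
  by rewrite -[leRHS]powRr1 ?ler_powR //; lra.
have := metric_triangle s0 w x; rewrite (metric_sym w x) /u in wu *; lra.
Qed.
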